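(* Let $p_0:=\log 4/\log 6$ and let $m,d\ge 1$ be integers. If $A\subset\{0,1\}^d$ and $B\subset\{0,1,\ldots,m\}^d$, then $$|A+B|\ge(|A|\,|B|)^{p_0}.$$ Moreover, for every $m\ge 2$ the exponent $p_0$ is best possible: for every integer $m\ge 2$ and every real $p>p_0$ there exist an integer $d\ge 1$ and sets $A\subset\{0,1\}^d$, $B\subset\{0,1,\ldots,m\}^d$ with $|A+B|<(|A|\,|B|)^p$.
   Context: $A+B=\{a+b:a\in A,\ b\in B\}$ is the Minkowski sum in $\mathbb Z^d$, $|\cdot|$ denotes cardinality, and $0^p=0$ for $p>0$. *)

(* Defs.v *)
From HB Require Import structures.
From mathcomp Require Import all_boot all_order all_algebra.
From mathcomp Require Import finmap.
From mathcomp Require Import reals exp.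

Set Implicit Arguments.
Unset Strict Implicit.
Unset Printing Implicit Defensive.

Import Order.TTheory GRing.Theory Num.Theory.

Local Open Scope ring_scope.

(* {0, 1, ..., m}^d as a subset of Z^d *)
Definition box (m d : nat) : pred 'rV[int]_d :=
  [pred v : 'rV[int]_d | [forall i, 0 <= v ord0 i <= m%:Z]].

Arguments box : clear implicits.

Definition minkowski_sum (V : zmodType) (A B : {fset V}) : {fset V} :=
  [fset (a + b)%R | a in A, b in B]%fset.

Definition p0 (R : realType) : R := ln 4 / ln 6.

(* Main.v *)
Require Import Defs.
From HB Require Import structures.
From mathcomp Require Import all_boot all_order all_algebra.
From mathcomp Require Import finmap.
From mathcomp Require Import reals exp.
From mathcomp Require Import classical_sets topology normedtype derive realfun.
From mathcomp Require Import ring lra zify.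

Set Implicit Arguments.
Unset Strict Implicit.
Unset Printing Implicit Defensive.

Import Order.TTheory GRing.Theory Num.Theory.
Import numFieldNormedType.Exports.

Local Open Scope ring_scope.

(** Cut [A] and [B] along one coordinate into slices [A_0], [A_1] and
    [B_0], ..., [B_m].  The slice of [A + B] at height [k] contains both
    [A_0 + B_k] and [A_1 + B_(k-1)], so induction on the coordinates reduces
    the lower bound to a numerical inequality ([slice_ineq]): with
    [p = ln 4 / ln 6], if [c_k] dominates [(a_0 b_k)^p] and
    [(a_1 b_(k-1))^p], then [((a_0 + a_1) * sum_k b_k)^p <= sum_k c_k].

    By symmetry let [a_1 = t a_0] with [t <= 1], and put [x_k = b_k^p] and
    [s = t^p].  For a fixed [s], the least admissible sum of the [c_k] is a
    piecewise linear function of [x], and the extreme rays of its linearity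
    cones are the geometric blocks [(1, s, ..., s^(n-1))], whose cost is
    [1 + s + ... + s^n].  The other side is a norm of [x], hence convex, so it
    is enough to compare the two sides on the blocks.  This convexity argument
    is carried out dually: Hoelder's inequality ([powR_holder]) linearises the
    norm, and [le_of_geom_tests] bounds a linear form by its values on
    geometric blocks.  What is left is [geom_ineq]:
    [((1 + t) (1 + t + ... + t^(n-1)))^p <= 1 + t^p + ... + t^(np)].

    At [t = 1] this reads [(2n)^p <= n + 1], an equality for [n = 3]: that is
    the definition of [p].  For [n >= 4] it propagates from [n] to [n + 1]
    because [8^p <= 5] ([geom_step]).  For [n = 2, 3, 4], the logarithm of the
    ratio of the two sides decreases on [[1/4, 1]], where
    [tanh (p artanh T)], with [T = (1 - t) / (1 + t)], is controlled by its
    Taylor polynomial, and on [[0, 1/4]] Bernoulli's inequality suffices.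

    The exponent is optimal already in dimension one: [{0, 1} + {0, 1, 2}] has
    4 elements, and [4 = 6^p]. *)

(** * Powers with exponent between 0 and 1 *)

Section Powers.
Variable R : realType.
Implicit Types (p t u v : R).

Lemma powRV p t : 0 <= t -> t^-1 `^ p = (t `^ p)^-1.
Proof. by move=> t0; rewrite -powR_inv1// -powRrM mulN1r powRN. Qed.

Lemma powR_exprn p t n : 0 <= t -> (t ^+ n) `^ p = (t `^ p) ^+ n.
Proof.
move=> t0; elim: n => [|n IH]; first by rewrite !expr0 powR1.
by rewrite !exprS powRM ?exprn_ge0// IH.
Qed.

(** Weighted arithmetic-geometric mean inequality, that is, Young's inequality
    for the conjugate exponents [1 / (1 - p)] and [1 / p]. *)
Lemma powR_amgm p u v : 0 < p < 1 -> 0 <= u -> 0 <= v ->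
  u `^ (1 - p) * v `^ p <= (1 - p) * u + p * v.
Proof.
move=> /andP[p0 p1] u0 v0.
have q0 : 0 < 1 - p by rewrite subr_gt0.
have := @conjugate_powR _ (u `^ (1 - p)) (v `^ p) (1 - p)^-1 p^-1
  (powR_ge0 _ _) (powR_ge0 _ _).
rewrite !invrK !invr_gt0 -!powRrM !mulfV ?gt_eqF// !powRr1//.
by move=> /(_ q0 p0 (subrK _ _)); rewrite [u * _]mulrC [v * _]mulrC.
Qed.

Lemma powR_bernoulli p u : 0 < p < 1 -> 0 <= u -> u `^ p <= 1 + p * (u - 1).
Proof.
move=> p01 u0; have := powR_amgm p01 ler01 u0; rewrite powR1 mul1r => h.
by apply: (le_trans h); rewrite mulr1 mulrBr mulr1 addrCA addrC addrAC.
Qed.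

(** Hoelder's inequality for finite sums: normalise both sums to 1 and apply
    the weighted mean inequality termwise. *)
Lemma powR_holder p n (u v : nat -> R) : 0 < p < 1 ->
  (forall k, 0 <= u k) -> (forall k, 0 <= v k) ->
  \sum_(k < n) u k `^ (1 - p) * v k `^ p <=
  (\sum_(k < n) u k) `^ (1 - p) * (\sum_(k < n) v k) `^ p.
Proof.
move=> p01 u0 v0; have /andP[p_gt0 p_lt1] := p01.
have q0 : 0 < 1 - p by rewrite subr_gt0.
have zero (f : nat -> R) r : (forall k, 0 <= f k) -> 0 < r ->
    \sum_(k < n) f k = 0 -> forall k : 'I_n, f k `^ r = 0.
  move=> f0 r0 /eqP; rewrite psumr_eq0// => /allP h k.
  have /eqP -> := h k (mem_index_enum _); by rewrite powR0 ?gt_eqF.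
have su0 : 0 <= \sum_(k < n) u k by rewrite sumr_ge0.
have sv0 : 0 <= \sum_(k < n) v k by rewrite sumr_ge0.
have [zu|nu] := eqVneq (\sum_(k < n) u k) 0.
  rewrite big1 ?mulr_ge0 ?powR_ge0// => k _.
  by rewrite (zero _ _ u0 q0 zu) mul0r.
have [zv|nv] := eqVneq (\sum_(k < n) v k) 0.
  rewrite big1 ?mulr_ge0 ?powR_ge0// => k _.
  by rewrite (zero _ _ v0 p_gt0 zv) mulr0.
have U0 : 0 < \sum_(k < n) u k by rewrite lt_def nu.
have V0 : 0 < \sum_(k < n) v k by rewrite lt_def nv.
set U := \sum_(k < n) u k in su0 nu U0 *; set V := \sum_(k < n) v k in sv0 nv V0 *.
rewrite -[leRHS]mulr1 -ler_pdivrMl ?mulr_gt0 ?powR_gt0// mulr_sumr.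
apply: (@le_trans _ _ (\sum_(k < n) ((1 - p) * (u k / U) + p * (v k / V)))); last first.
  rewrite big_split/= -!mulr_sumr -!mulr_suml -/U -/V !divff// !mulr1.
  by rewrite subrK.
apply: ler_sum => k _.
apply: le_trans (powR_amgm p01 (divr_ge0 (u0 k) su0) (divr_ge0 (v0 k) sv0)).
by rewrite !powRM ?invr_ge0// !powRV// mulrACA -invfM [leRHS]mulrC.
Qed.

(** Both [1 / (1 + t)] and [t / (1 + t)] lie in [[0, 1]], where [u <= u^p];
    they add up to 1. *)
Lemma powR_subadd p t : 0 < p <= 1 -> 0 <= t -> (1 + t) `^ p <= 1 + t `^ p.
Proof.
move=> /andP[p0 p1] t0; have z0 : 0 < 1 + t by rewrite ltr_wpDr.
have le_pow (u : R) : 0 <= u <= 1 -> u <= u `^ p.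
  move=> /andP[]; rewrite le_eqVlt => /predU1P[<- _|u0 u1].
    exact: powR_ge0.
  by apply: ger1_powR => //; rewrite u0.
have h1 : (1 + t)^-1 <= ((1 + t)^-1) `^ p.
  by apply: le_pow; rewrite invr_ge0 ltW//= invf_le1 // lerDl.
have h2 : t / (1 + t) <= (t / (1 + t)) `^ p.
  by apply: le_pow; rewrite divr_ge0 ?(ltW z0)//= ler_pdivrMr// mul1r lerDr.
have := lerD h1 h2; rewrite -{1}[(1 + t)^-1]mul1r -mulrDl divff ?gt_eqF//.
rewrite powRM ?invr_ge0 ?(ltW z0)// -{1}[_^-1 `^ _]mul1r -mulrDl.
by rewrite powRV ?(ltW z0)// ler_pdivlMr ?powR_gt0// mul1r.
Qed.
End Powers.

(** * Numerical bounds on the exponent *)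

Section Exponent.
Variable R : realType.
Local Notation p := (p0 R).

(** Rational bounds on quotients of logarithms come from comparing powers of
    integers. *)
Lemma ln_nat_le (a b m n : nat) : (0 < a)%N -> (0 < b)%N ->
  (a ^ m <= b ^ n)%N -> m%:R * ln (a%:R : R) <= n%:R * ln (b%:R : R).
Proof.
move=> a0 b0 h; rewrite ![_ * ln _]mulr_natl -!lnXn ?ltr0n// -!natrX.
by rewrite ler_ln ?posrE ?ltr0n ?expn_gt0 ?a0 ?b0// ler_nat.
Qed.

Lemma ln2_gt0 : 0 < ln (2 : R). Proof. by rewrite ln_gt0 ?ltr1n. Qed.

Lemma ln6_gt0 : 0 < ln (6 : R). Proof. by rewrite ln_gt0 ?ltr1n. Qed.

Lemma ln4E : ln (4 : R) = 2 * ln 2.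
Proof. by rewrite (_ : 4 = 2 ^+ 2) ?lnXn ?mulr_natl// -natrX. Qed.

Lemma ln8E : ln (8 : R) = 3 * ln 2.
Proof. by rewrite (_ : 8 = 2 ^+ 3) ?lnXn ?mulr_natl// -natrX. Qed.

Lemma p0_bounds : 41 / 53 <= p <= 24 / 31.
Proof.
rewrite /p0 ler_pdivlMr ?ln6_gt0// ler_pdivrMr ?ln6_gt0//.
have := @ln_nat_le 6 4 41 53 isT isT ltac:(lia).
have := @ln_nat_le 4 6 31 24 isT isT ltac:(lia).
lra.
Qed.

Lemma pow6_p0 : (6 : R) `^ p = 4.
Proof.
rewrite /powR gt_eqF ?ltr0n// /p0 divfK ?gt_eqF ?ln6_gt0//.
by rewrite lnK// posrE ltr0n.
Qed.

(** The claim is [6 (ln 2)^2 <= ln 5 * ln 6], which holds with a relative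
    margin below 4/10000; the fractions 65/28 and 168/65 are lower bounds
    for [ln 5 / ln 2] and [ln 6 / ln 2] whose product is exactly 6. *)
Lemma pow8_p0 : (8 : R) `^ p <= 5.
Proof.
rewrite /powR gt_eqF ?ltr0n// -[leRHS]lnK ?posrE ?ltr0n// ler_expR /p0.
rewrite mulrAC ler_pdivrMr ?ln6_gt0// ln4E ln8E.
have h6 := @ln_nat_le 2 6 168 65 isT isT ltac:(lia).
have h5 := @ln_nat_le 2 5 65 28 isT isT ltac:(lia).
(* 65/28 * (168/65) = 6 *)
have l2 := ln2_gt0.
have -> : 2 * ln 2 * (3 * ln 2) = (65 / 28 * ln 2) * (168 / 65 * ln (2 : R)).
  by field.
by apply: ler_pM; lra.
Qed.

(** [(4^p)^3 = (8^p)^2 <= 25], and 117/40 is just above the cube root of 25. *)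
Lemma pow4_p0 : (4 : R) `^ p <= 117 / 40.
Proof.
have h : ((4 : R) `^ p) ^+ 3 <= 5 ^+ 2.
  have -> : ((4 : R) `^ p) ^+ 3 = (8 `^ p) ^+ 2.
    by rewrite -!powR_exprn//; congr (_ `^ _); ring.
  by rewrite lerXn2r ?nnegrE ?powR_ge0 ?pow8_p0.
rewrite -(@ler_pXn2r _ 3) ?nnegrE ?powR_ge0//; last lra.
apply: (le_trans h); lra.
Qed.
End Exponent.

(** * Monotonicity and the bound on tanh (p artanh T) *)

Section Calculus.
Variable R : realType.

Lemma le_of_derive_le0 (f df : R -> R) (a b : R) : a <= b ->
  (forall x, a <= x <= b -> is_derive x 1 f (df x)) ->
  (forall x, a <= x <= b -> df x <= 0) -> f b <= f a.
Proof.
move=> ab fdf df0.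
have [||c] := @MVT_segment _ f df a b ab.
- by move=> x /subset_itv_oo_cc; rewrite in_itv; exact: fdf.
- apply: derivable_within_continuous => x; rewrite in_itv/= => xab.
  by have /@ex_derive := fdf _ xab.
rewrite in_itv/= => /df0 dfc fE; rewrite -subr_le0 fE.
by rewrite mulr_le0_ge0// subr_ge0.
Qed.

Lemma is_derive_ln (g : R -> R) (x dg : R) : 0 < g x ->
  is_derive x 1 g dg -> is_derive x 1 (fun z => ln (g z)) (dg / g x).
Proof.
move=> gx0 gdg; have lnd := @is_derive1_ln _ _ gx0.
by rewrite mulrC; exact: (is_derive1_comp lnd gdg).
Qed.

(** With [T = tanh h], the number [(1 - T) / (1 + T)] is [exp (- 2 h)], so
    the lemma says [a T + l T^3 <= tanh (a h)].  It compares
    [tanh (a artanh T) = a T + (a - a^3) / 3 * T^3 + ...] with the beginning of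
    its Taylor expansion, through the derivatives of the two inverse hyperbolic
    tangents. *)
Lemma powR_le_moebius (a l T : R) : 0 < a <= 1 -> 0 <= l ->
  3 * l <= a - a ^+ 3 -> 0 <= T < 1 ->
  (a * T + l * T ^+ 3) * (1 + ((1 - T) / (1 + T)) `^ a) <=
  1 - ((1 - T) / (1 + T)) `^ a.
Proof.
move=> /andP[a0 a1] l0 la /andP[T0 T1].
pose S (x : R) := a * x + l * x ^+ 3.
pose dS (x : R) := a + l * (3 * x ^+ 2).
have al1 : a + l <= 1.
  have := mulr_ge0 (ltW a0) (sqr_ge0 (1 - a)).
  have := mulr_ge0 (sqr_ge0 (1 - a)) (ltW a0); nra.
have S01 x : 0 <= x -> x <= T -> 0 <= S x < 1.
  move=> x0 xT; have x1 : x < 1 by apply: le_lt_trans T1.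
  have /andP[c0 c1] : 0 <= x ^+ 3 <= x.
    by rewrite exprn_ge0//= -[leRHS]expr1 ler_wiXn2l// ltW.
  rewrite /S addr_ge0 ?mulr_ge0 ?(ltW a0)//=.
  have := ler_wpM2l l0 c1; have := ler_wpM2r x0 al1; lra.
pose f x := ln (1 + S x) - ln (1 - S x) - a * (ln (1 + x) - ln (1 - x)).
have f0T : f T <= f 0.
  apply: (@le_of_derive_le0 f (fun x => dS x / (1 + S x) + dS x / (1 - S x)
      - a * ((1 + x)^-1 + (1 - x)^-1))) => // x /andP[x0 xT].
    have /andP[s0 s1] := S01 x x0 xT.
    have x1 : 0 < 1 - x by lra.
    have x2 : 0 < 1 + x by lra.
    have s2 : 0 < 1 + S x by lra.
    have s3 : 0 < 1 - S x by lra.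
    have dSx : is_derive x 1 S (dS x).
      rewrite /S /dS; apply: is_derive_eq.
      by rewrite /GRing.scale/=; ring.
    have d1 : is_derive x 1 (fun z => 1 + S z) (dS x).
      by rewrite -[dS x]add0r; exact: is_deriveD.
    have d2 : is_derive x 1 (fun z => 1 - S z) (- dS x).
      by rewrite -[- dS x]add0r; exact: is_deriveB.
    have d3 : is_derive x 1 (fun z : R => 1 + z) 1.
      apply: (is_derive_eq _ (add0r _));
        exact: (is_deriveD (is_derive_cst 1 x 1) (is_derive_id x 1)).
    have d4 : is_derive x 1 (fun z : R => 1 - z) (-1).
      apply: (is_derive_eq _ (add0r _));
        exact: (is_deriveB (is_derive_cst 1 x 1) (is_derive_id x 1)).
    have e1 := @is_derive_ln (fun z => 1 + S z) x _ s2 d1.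
    have e2 := @is_derive_ln (fun z => 1 - S z) x _ s3 d2.
    have e3 := @is_derive_ln (fun z => 1 + z) x _ x2 d3.
    have e4 := @is_derive_ln (fun z => 1 - z) x _ x1 d4.
    have h := is_deriveB (is_deriveB e1 e2) (is_deriveZ a (is_deriveB e3 e4)).
    apply: (@is_derive_eq _ _ _ f _ _ _ _ h).
    rewrite /GRing.scale/=.
    by rewrite mulN1r mul1r !mulNr !opprK.
  have /andP[s0 s1] := S01 x x0 xT.
  rewrite -mulrDr.
  have E (y : R) : -1 < y < 1 ->
      (1 + y)^-1 + (1 - y)^-1 = 2 / (1 - y ^+ 2).
    by move=> /andP[y1 y2]; field; rewrite !gt_eqF//=; nra.
  rewrite !E; try lra.
  have sx0 : 0 < 1 - S x ^+ 2 by nra.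
  have xx0 : 0 < 1 - x ^+ 2 by nra.
  rewrite subr_le0 !mulrA ler_pdivrMr// mulrAC ler_pdivlMr//.
  suff : dS x * (1 - x ^+ 2) <= a * (1 - S x ^+ 2) by lra.
  have -> : a * (1 - S x ^+ 2) = dS x * (1 - x ^+ 2) +
      (x ^+ 2 * (a - a ^+ 3 - 3 * l) +
       l * x ^+ 4 * (3 - 2 * a ^+ 2 - a * (l * x ^+ 2))).
    by rewrite /S /dS; ring.
  rewrite lerDl addr_ge0 ?mulr_ge0 ?sqr_ge0 ?exprn_even_ge0 ?subr_ge0//.
  have : l * x ^+ 2 <= 1 by nra.
  nra.
rewrite /f /S !mulr0 expr0n/= mulr0 !addr0 !subr0 !subrr mulr0 subr0 -/(S T) in f0T.
have t0 : 0 < (1 - T) / (1 + T) by rewrite divr_gt0; lra.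
set x := _ `^ a.
have x0 : 0 < x by rewrite powR_gt0.
have /andP[s0 s1] := S01 T T0 (lexx T).
have lnx : ln x = a * (ln (1 - T) - ln (1 + T)).
  by rewrite /x ln_powR ln_div ?posrE//; lra.
suff : x <= (1 - S T) / (1 + S T).
  rewrite ler_pdivlMr; last lra.
  by rewrite /S; lra.
rewrite -ler_ln ?posrE ?divr_gt0//; try lra.
rewrite ln_div ?posrE//; lra.
Qed.
End Calculus.

(** * Comparison by logarithmic derivatives *)

Section LogDerivative.
Variable R : realType.

(** The condition on the derivatives says that, as a function of [ln t],
    [ln (F (t^p)) - p * ln (G t)] decreases; it is nonnegative at [t = 1]. *)
Lemma powR_le_of_logderiv (p t0 : R) (F G dF dG : R -> R) :
  0 < p -> 0 < t0 ->
  (forall x, 0 < x -> 0 < F x) -> (forall t, 0 < t -> 0 < G t) ->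
  (forall x : R, 0 < x -> is_derive x 1 F (dF x)) ->
  (forall t : R, 0 < t -> is_derive t 1 G (dG t)) ->
  (forall t, t0 <= t <= 1 ->
     t `^ p * dF (t `^ p) * G t <= t * dG t * F (t `^ p)) ->
  G 1 `^ p <= F 1 -> forall t, t0 <= t <= 1 -> G t `^ p <= F (t `^ p).
Proof.
move=> p0 t00 F0 G0 FdF GdG slope FG1 t /andP[tt0 t1].
pose f z := ln (F (z `^ p)) - p * ln (G z).
have : f 1 <= f t.
  apply: (@le_of_derive_le0 _ f (fun z =>
     dF (z `^ p) * (p * z `^ (p - 1)) / F (z `^ p) - p * (dG z / G z))) => //.
    move=> z /andP[tz z1]; have z0 : 0 < z by lra.
    have x0 : 0 < z `^ p by rewrite powR_gt0.
    have e0 := @is_derive1_comp R F (fun y => y `^ p) z _ _ (FdF (z `^ p) x0)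
      (is_derive1_powR p z0).
    have e1 := @is_derive_ln _ (fun z => F (z `^ p)) z _ (F0 _ x0) e0.
    have e2 := @is_derive_ln _ G z _ (G0 _ z0) (GdG _ z0).
    have h := is_deriveB e1 (is_deriveZ p e2).
    apply: (@is_derive_eq _ _ _ f _ _ _ _ h).
    by [].
  move=> z /andP[tz z1]; have z0 : 0 < z by lra.
  have x0 : 0 < z `^ p by rewrite powR_gt0.
  have Fx := F0 _ x0; have Gz := G0 _ z0.
  have xE := mulr_powRB1 (ltW z0) p0.
  rewrite subr_le0 ler_pdivrMr// (mulrA p) (mulrAC _ (G z)^-1) ler_pdivlMr//.
  rewrite -(ler_pM2l z0).
  have := ler_wpM2l (ltW p0) (slope z _).
  rewrite z1 (le_trans tt0 tz) => /(_ isT); congr (_ <= _); last by ring.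
  by rewrite -{1}xE; ring.
rewrite /f powR1 => h.
have t_gt0 : 0 < t by lra.
rewrite -ler_ln ?posrE ?powR_gt0 ?F0 ?G0 ?powR_gt0// ln_powR -subr_ge0.
apply: le_trans h; rewrite subr_ge0 -ln_powR.
by rewrite ler_ln// posrE ?powR_gt0 ?F0 ?G0.
Qed.
End LogDerivative.

(** * Polynomial inequalities with rational coefficients *)

Section RationalEstimates.
Variable R : realFieldType.
Implicit Types (s u t x y T : R).

(** Lower bound for [tanh (p artanh T)]: 41/53 is slightly below [p], and
    103/1000 slightly below a third of [a - a^3] for [a = 41/53]. *)
Definition tanh_minorant T : R := T * (41 / 53 + 103 / 1000 * T ^+ 2).

(** The inequalities [slope2], [slope3] and [slope4] state that the logarithmic
    derivatives of the two sides of the geometric inequality with 2, 3 and 4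
    terms are in the right order, written in the variables
    [T = (1 - t) / (1 + t)] and [u = (1 - t^p) / (1 + t^p)].  In each of them
    the quotient of the two factors depending on [u] increases with [u], so
    only the smallest allowed value of [u], a polynomial in [T], matters. *)
Lemma slope2 T u : 0 <= T <= 3 / 5 -> tanh_minorant T <= u <= 1 ->
  T * (3 + u ^+ 2) <= 4 * u.
Proof.
rewrite /tanh_minorant => /andP[T0 T1]; set r := 41 / 53 + _; set y := T ^+ 2.
have y01 : 0 <= y <= 9 / 25 by rewrite /y; nra.
have r0 : 0 <= r by rewrite /r -/y; lra.
have key : 3 + r ^+ 2 * y <= 4 * r by rewrite /r -/y; nra.
have s0 := mulr_ge0 T0 r0; set s := T * r in s0 *.
move=> /andP[su u1].
have ks : T * (3 + s ^+ 2) <= 4 * s.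
  have := ler_wpM2l T0 key; rewrite /s exprMn -/y; lra.
have mono : s * (3 + u ^+ 2) <= u * (3 + s ^+ 2).
  rewrite -subr_ge0 (_ : _ - _ = (u - s) * (3 - s * u)); last by ring.
  by rewrite mulr_ge0//; nra.
have c0 : 0 < 3 + s ^+ 2 by nra.
have u20 : 0 <= 3 + u ^+ 2 by nra.
rewrite -(ler_pM2r c0).
have := ler_wpM2r u20 ks; lra.
Qed.

Lemma slope3 T u : 0 <= T <= 3 / 5 -> tanh_minorant T <= u <= 1 ->
  T * (11 + T ^+ 2) * (1 + u ^+ 2) <= u * (5 + u ^+ 2) * (3 + T ^+ 2).
Proof.
rewrite /tanh_minorant => /andP[T0 T1]; set r := 41 / 53 + _; set y := T ^+ 2.
have y01 : 0 <= y <= 9 / 25 by rewrite /y; nra.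
have r0 : 0 <= r by rewrite /r -/y; lra.
have key : (11 + y) * (1 + r ^+ 2 * y) <= r * (5 + r ^+ 2 * y) * (3 + y).
  by rewrite /r -/y; nra.
have s0 := mulr_ge0 T0 r0; set s := T * r in s0 *.
move=> /andP[su u1].
have ks : T * (11 + y) * (1 + s ^+ 2) <= s * (5 + s ^+ 2) * (3 + y).
  have := ler_wpM2l T0 key; rewrite /s exprMn -/y; lra.
have mono : s * (5 + s ^+ 2) * (1 + u ^+ 2) <= u * (5 + u ^+ 2) * (1 + s ^+ 2).
  rewrite -subr_ge0 (_ : _ - _ = (u - s) *
    (5 * (1 - s * u) + (u ^+ 2 + u * s + s ^+ 2 + s ^+ 2 * u ^+ 2))); last by ring.
  by rewrite mulr_ge0//; nra.
have c0 : 0 < 1 + s ^+ 2 by nra.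
have y3 : 0 <= 3 + y by lra.
have u20 : 0 <= 1 + u ^+ 2 by nra.
rewrite -(ler_pM2r c0).
have := ler_wpM2r u20 ks; have := ler_wpM2r y3 mono; lra.
Qed.

Lemma slope4 T u : 0 <= T <= 3 / 5 -> tanh_minorant T <= u <= 1 ->
  T * (3 + T ^+ 2) * (5 + 10 * u ^+ 2 + u ^+ 4) <=
  4 * u * (5 + 3 * u ^+ 2) * (1 + T ^+ 2).
Proof.
rewrite /tanh_minorant => /andP[T0 T1]; set r := 41 / 53 + _; set y := T ^+ 2.
have y01 : 0 <= y <= 9 / 25 by rewrite /y; nra.
have r0 : 0 <= r by rewrite /r -/y; lra.
have key : (3 + y) * (5 + 10 * r ^+ 2 * y + r ^+ 4 * y ^+ 2) <=
    4 * r * (5 + 3 * r ^+ 2 * y) * (1 + y).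
  by rewrite /r -/y; nra.
have s0 := mulr_ge0 T0 r0; set s := T * r in s0 *.
move=> /andP[su u1].
have ks : T * (3 + y) * (5 + 10 * s ^+ 2 + s ^+ 4) <=
    4 * s * (5 + 3 * s ^+ 2) * (1 + y).
  have := ler_wpM2l T0 key.
  by rewrite /s !exprMn (_ : T ^+ 4 = y ^+ 2) -/y; [lra|rewrite /y; ring].
have mono : s * (5 + 3 * s ^+ 2) * (5 + 10 * u ^+ 2 + u ^+ 4) <=
    u * (5 + 3 * u ^+ 2) * (5 + 10 * s ^+ 2 + s ^+ 4).
  have m0 : 0 <= s * u <= 1 by nra.
  rewrite -subr_ge0 (_ : _ - _ = (u - s) * (
    (25 - 5 * (s * u) + 15 * (s * u) ^+ 2 - 3 * (s * u) ^+ 3) +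
    (u - s) ^+ 2 * (15 - 5 * (s * u)))); last by ring.
  have m3 : 0 <= 25 - 5 * (s * u) + 15 * (s * u) ^+ 2 - 3 * (s * u) ^+ 3 by nra.
  have d0 : 0 <= u - s by lra.
  rewrite (mulr_ge0 d0)//; apply: (addr_ge0 m3).
  by rewrite mulr_ge0 ?sqr_ge0//; lra.
have c0 : 0 < 5 + 10 * s ^+ 2 + s ^+ 4.
  have := exprn_even_ge0 s (isT : ~~ odd 4); nra.
have u20 : 0 <= 5 + 10 * u ^+ 2 + u ^+ 4.
  have := exprn_even_ge0 u (isT : ~~ odd 4); nra.
rewrite -(ler_pM2r c0).
have y1 : 0 <= 1 + y by lra.
have := ler_wpM2r u20 ks; have := ler_wpM2r y1 mono; lra.
Qed.

(** Lower bound for [t^p / t] on [[0, 1/4]]: the second-order expansion at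
    [t = 1/4] of the reciprocal of [117/160 * (24/31 + 28/31 t)], with its
    coefficients rounded down. *)
Definition ratio_minorant t : R :=
  1367 / 1000 + 1235 / 1000 * (1 / 4 - t) + 1115 / 1000 * (1 / 4 - t) ^+ 2.

Lemma ratio_minorant_le x t : 0 <= t <= 1 / 4 -> 0 <= x ->
  t <= x * (117 / 160 * (24 / 31 + 28 / 31 * t)) ->
  0 <= t * ratio_minorant t <= x.
Proof.
move=> /andP[t0 t1] x0 h.
have [q0 q1] : 0 <= ratio_minorant t /\
    117 / 160 * (24 / 31 + 28 / 31 * t) * ratio_minorant t <= 1.
  rewrite /ratio_minorant; set s := 1 / 4 - t.
  have -> : t = 1 / 4 - s by rewrite /s; ring.
  have s0 : 0 <= s by rewrite /s; lra.
  have := exprn_ge0 2 s0; have := exprn_ge0 3 s0.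
  have : s <= 1 / 4 by rewrite /s; lra.
  by split; lra.
rewrite mulr_ge0//=; apply: le_trans (ler_wpM2r q0 h) _.
by have := ler_wpM2l x0 q1; lra.
Qed.

Lemma ratio_minorant_ge t : 0 <= t <= 1 / 4 -> let q := ratio_minorant t in
  [/\ 24 / 31 * (2 + t) <= q + t * q ^+ 2,
      24 / 31 * (2 + 2 * t + t ^+ 2) <= q + t * q ^+ 2 + t ^+ 2 * q ^+ 3 &
      24 / 31 * (2 + 2 * t + 2 * t ^+ 2 + t ^+ 3) <=
      q + t * q ^+ 2 + t ^+ 2 * q ^+ 3 + t ^+ 3 * q ^+ 4].
Proof.
move=> /andP[t0 t1]; rewrite /ratio_minorant; set s := 1 / 4 - t.
have -> : t = 1 / 4 - s by rewrite /s; ring.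
have s0 : 0 <= s by rewrite /s; lra.
have s1 : s <= 1 / 4 by rewrite /s; lra.
have pow_s k : 0 <= s ^+ k.+1 <= 1 / 4 * s ^+ k.
  by rewrite exprn_ge0//= exprS ler_wpM2r // exprn_ge0.
move: (pow_s 0%N) (pow_s 1%N) (pow_s 2%N) (pow_s 3%N) (pow_s 4%N) (pow_s 5%N)
  (pow_s 6%N) (pow_s 7%N) (pow_s 8%N) (pow_s 9%N) (pow_s 10%N).
do 11 (move=> /andP[? ?]).
by split; lra.
Qed.
End RationalEstimates.

(** * The geometric inequality for two, three and four terms *)

Section GeometricInequality.
Variable R : realType.
Local Notation p := (p0 R).
Implicit Types (t x T u : R).

Lemma p0_in01 : 0 < p < 1.
Proof. by have /andP[] := p0_bounds R; lra. Qed.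

Lemma tanh_minorant_ge0 T : 0 <= T -> 0 <= tanh_minorant T.
Proof. by move=> T0; apply: mulr_ge0 => //; have := sqr_ge0 T; lra. Qed.

(** The substitution used on [[1/4, 1]]: [t] and [t^p] are the images of [T]
    and [u] under the involution [z |-> (1 - z) / (1 + z)]. *)
Lemma powR_p0_tanh t : 1 / 4 <= t <= 1 ->
  let T := (1 - t) / (1 + t) in let u := (1 - t `^ p) / (1 + t `^ p) in
  [/\ 0 <= T <= 3 / 5, tanh_minorant T <= u <= 1,
      t = (1 - T) / (1 + T) & t `^ p = (1 - u) / (1 + u)].
Proof.
move=> /andP[t0 t1] T u; have /andP[pl pu] := p0_bounds R.
have z0 : 0 < 1 + t by lra.
have T0 : 0 <= T by rewrite divr_ge0; lra.
have T1 : T <= 3 / 5 by rewrite ler_pdivrMr//; lra.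
have tE : t = (1 - T) / (1 + T).
  by rewrite /T; field; apply/andP; split; rewrite gt_eqF//; lra.
have x0 : 0 < t `^ p by rewrite powR_gt0; lra.
have x1 : 0 < 1 + t `^ p by lra.
have xE : t `^ p = (1 - u) / (1 + u).
  by rewrite /u; field; apply/andP; split; rewrite gt_eqF//; lra.
split=> //; first by rewrite T0.
rewrite ler_pdivlMr// ler_pdivrMr//; apply/andP; split; last by lra.
have a01 : 0 < (41 / 53 : R) <= 1 by lra.
have T01 : 0 <= T < 1 by rewrite T0; lra.
have l0 : 0 <= (103 / 1000 : R) by lra.
have la : 3 * (103 / 1000 : R) <= 41 / 53 - (41 / 53) ^+ 3 by lra.
have := powR_le_moebius a01 l0 la T01; rewrite -tE.
have -> : 41 / 53 * T + 103 / 1000 * T ^+ 3 = tanh_minorant T.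
  by rewrite /tanh_minorant; ring.
have s0 := tanh_minorant_ge0 T0.
have xy : t `^ p <= t `^ (41 / 53).
  by apply: ger_powR => //; apply/andP; split; lra.
have := ler_wpM2l s0 xy; lra.
Qed.

(** Since [4 t = (4 t)^p (4 t)^(1-p)], the mean inequality applied to the
    second factor bounds [t^p] from below by a rational function of [t]. *)
Lemma powR_p0_ratio t : 0 <= t <= 1 / 4 -> 0 <= t * ratio_minorant t <= t `^ p.
Proof.
move=> t01; apply: ratio_minorant_le => //; first exact: powR_ge0.
have /andP[t0 t1] := t01; have /andP[pl pu] := p0_bounds R.
have w0 : 0 <= 4 * t by lra.
have := powR_amgm p0_in01 w0 ler01; rewrite powR1 !mulr1 => h1.
have h2 : t `^ p * 4 `^ p <= t `^ p * (117 / 40).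
  by rewrite ler_wpM2l ?powR_ge0// pow4_p0.
have wE : (4 * t) `^ (1 - p) * (t `^ p * 4 `^ p) = 4 * t.
  rewrite [t `^ p * _]mulrC -powRM// -powRD ?subrK ?powRr1//.
  by apply/implyP; rewrite oner_eq0.
have h3 : (1 - p) * (4 * t) + p <= 24 / 31 + 28 / 31 * t by nra.
have := ler_wpM2r (powR_ge0 t p) (le_trans h1 h3).
have := ler_wpM2l (powR_ge0 (4 * t) (1 - p)) h2.
lra.
Qed.

Lemma powR_p0_le_affine t : 1 <= t -> t `^ p <= 1 + 24 / 31 * (t - 1).
Proof.
move=> t1; have /andP[_ pu] := p0_bounds R.
apply: le_trans (powR_bernoulli p0_in01 _) _; first by lra.
by rewrite lerD2l ler_wpM2r// subr_ge0.
Qed.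

(** In [geom_ineq2], [geom_ineq3] and [geom_ineq4] the left-hand sides are
    [((1 + t) (1 + ... + t^(n-1)))^p] expanded.  The range of [t] is cut
    at 1/4: below, the power is bounded by Bernoulli's inequality and [t^p] by
    [powR_p0_ratio]; above, the logarithmic derivatives are compared. *)
Lemma geom_ineq2 t : 0 <= t <= 1 ->
  (1 + 2 * t + t ^+ 2) `^ p <=
  1 + t `^ p + (t `^ p) ^+ 2.
Proof.
move=> /andP[t0 t1]; have [ht|ht] := lerP t (1 / 4).
  have t01 : 0 <= t <= 1 / 4 by rewrite t0.
  have /andP[y0 yx] := powR_p0_ratio t01; have [h _ _] := ratio_minorant_ge t01.
  apply: le_trans (powR_p0_le_affine _) _; first by nra.
  have y2 := lerXn2r 2 y0 (powR_ge0 t p) yx.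
  have := ler_wpM2l t0 h; lra.
pose F x := 1 + x + x ^+ 2.
pose G t := 1 + 2 * t + t ^+ 2.
pose dF x := 1 + 2 * x.
pose dG t := 2 + 2 * t.
apply: (@powR_le_of_logderiv _ p (1 / 4) F G dF dG); rewrite /F /G /dF /dG.
- by have /andP[] := p0_in01.
- by lra.
- by move=> x x0; have := sqr_ge0 x; lra.
- by move=> x x0; have := sqr_ge0 x; lra.
- by move=> x x0; apply: is_derive_eq; rewrite /GRing.scale/=; ring.
- by move=> x x0; apply: is_derive_eq; rewrite /GRing.scale/=; ring.
- move=> z /powR_p0_tanh[].
  move: ((1 - z) / (1 + z)) ((1 - z `^ p) / (1 + z `^ p)) => T u.
  move=> T01 u01 zE ->; rewrite {z}zE.
  have N0 := slope2 T01 u01.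
  have T0 : 0 < 1 + T by lra.
  have u0 : 0 < 1 + u.
    have /andP[T0' _] := T01; have /andP[+ _] := u01.
    by have := tanh_minorant_ge0 T0'; lra.
  rewrite -subr_ge0 (_ : _ - _ =
    4 * (4 * u - T * (3 + u ^+ 2)) /
    ((1 + u) ^+ 2 * (1 + T) ^+ 2)).
    by rewrite divr_ge0 ?mulr_ge0 ?exprn_ge0 ?subr_ge0 ?(ltW u0) ?(ltW T0).
  by field; apply/andP; split; rewrite gt_eqF.
- rewrite (_ : _ + 1 ^+ 2 = 4 :> R); last by ring.
  by rewrite !expr1n; have := pow4_p0 R; lra.
- by rewrite t1 (ltW ht).
Qed.

Lemma geom_ineq3 t : 0 <= t <= 1 ->
  (1 + 2 * t + 2 * t ^+ 2 + t ^+ 3) `^ p <=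
  1 + t `^ p + (t `^ p) ^+ 2 + (t `^ p) ^+ 3.
Proof.
move=> /andP[t0 t1]; have [ht|ht] := lerP t (1 / 4).
  have t01 : 0 <= t <= 1 / 4 by rewrite t0.
  have /andP[y0 yx] := powR_p0_ratio t01; have [_ h _] := ratio_minorant_ge t01.
  apply: le_trans (powR_p0_le_affine _) _; first by have := exprn_ge0 3 t0; nra.
  have y2 := lerXn2r 2 y0 (powR_ge0 t p) yx.
  have y3 := lerXn2r 3 y0 (powR_ge0 t p) yx.
  have := ler_wpM2l t0 h; lra.
pose F x := 1 + x + x ^+ 2 + x ^+ 3.
pose G t := 1 + 2 * t + 2 * t ^+ 2 + t ^+ 3.
pose dF x := 1 + 2 * x + 3 * x ^+ 2.
pose dG t := 2 + 4 * t + 3 * t ^+ 2.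
apply: (@powR_le_of_logderiv _ p (1 / 4) F G dF dG); rewrite /F /G /dF /dG.
- by have /andP[] := p0_in01.
- by lra.
- by move=> x x0; have := exprn_ge0 2 (ltW x0); have := exprn_ge0 3 (ltW x0);
    lra.
- by move=> x x0; have := exprn_ge0 2 (ltW x0); have := exprn_ge0 3 (ltW x0);
    lra.
- by move=> x x0; apply: is_derive_eq; rewrite /GRing.scale/=; ring.
- by move=> x x0; apply: is_derive_eq; rewrite /GRing.scale/=; ring.
- move=> z /powR_p0_tanh[].
  move: ((1 - z) / (1 + z)) ((1 - z `^ p) / (1 + z `^ p)) => T u.
  move=> T01 u01 zE ->; rewrite {z}zE.
  have N0 := slope3 T01 u01.
  have T0 : 0 < 1 + T by lra.
  have u0 : 0 < 1 + u.
    have /andP[T0' _] := T01; have /andP[+ _] := u01.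
    by have := tanh_minorant_ge0 T0'; lra.
  rewrite -subr_ge0 (_ : _ - _ =
    4 * (u * (5 + u ^+ 2) * (3 + T ^+ 2) -
       T * (11 + T ^+ 2) * (1 + u ^+ 2)) /
    ((1 + u) ^+ 3 * (1 + T) ^+ 3)).
    by rewrite divr_ge0 ?mulr_ge0 ?exprn_ge0 ?subr_ge0 ?(ltW u0) ?(ltW T0).
  by field; apply/andP; split; rewrite gt_eqF.
- rewrite (_ : _ + 1 ^+ 3 = 6 :> R); last by ring.
  by rewrite !expr1n; have := pow6_p0 R; lra.
- by rewrite t1 (ltW ht).
Qed.

Lemma geom_ineq4 t : 0 <= t <= 1 ->
  (1 + 2 * t + 2 * t ^+ 2 + 2 * t ^+ 3 + t ^+ 4) `^ p <=
  1 + t `^ p + (t `^ p) ^+ 2 + (t `^ p) ^+ 3 + (t `^ p) ^+ 4.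
Proof.
move=> /andP[t0 t1]; have [ht|ht] := lerP t (1 / 4).
  have t01 : 0 <= t <= 1 / 4 by rewrite t0.
  have /andP[y0 yx] := powR_p0_ratio t01; have [_ _ h] := ratio_minorant_ge t01.
  apply: le_trans (powR_p0_le_affine _) _.
    by have := exprn_ge0 3 t0; have := exprn_ge0 4 t0; nra.
  have y2 := lerXn2r 2 y0 (powR_ge0 t p) yx.
  have y3 := lerXn2r 3 y0 (powR_ge0 t p) yx.
  have y4 := lerXn2r 4 y0 (powR_ge0 t p) yx.
  have := ler_wpM2l t0 h; lra.
pose F x := 1 + x + x ^+ 2 + x ^+ 3 + x ^+ 4.
pose G t := 1 + 2 * t + 2 * t ^+ 2 + 2 * t ^+ 3 + t ^+ 4.
pose dF x := 1 + 2 * x + 3 * x ^+ 2 + 4 * x ^+ 3.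
pose dG t := 2 + 4 * t + 6 * t ^+ 2 + 4 * t ^+ 3.
apply: (@powR_le_of_logderiv _ p (1 / 4) F G dF dG); rewrite /F /G /dF /dG.
- by have /andP[] := p0_in01.
- by lra.
- by move=> x x0; have := exprn_ge0 2 (ltW x0); have := exprn_ge0 3 (ltW x0);
    have := exprn_ge0 4 (ltW x0); lra.
- by move=> x x0; have := exprn_ge0 2 (ltW x0); have := exprn_ge0 3 (ltW x0);
    have := exprn_ge0 4 (ltW x0); lra.
- by move=> x x0; apply: is_derive_eq; rewrite /GRing.scale/=; ring.
- by move=> x x0; apply: is_derive_eq; rewrite /GRing.scale/=; ring.
- move=> z /powR_p0_tanh[].
  move: ((1 - z) / (1 + z)) ((1 - z `^ p) / (1 + z `^ p)) => T u.
  move=> T01 u01 zE ->; rewrite {z}zE.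
  have N0 := slope4 T01 u01.
  have T0 : 0 < 1 + T by lra.
  have u0 : 0 < 1 + u.
    have /andP[T0' _] := T01; have /andP[+ _] := u01.
    by have := tanh_minorant_ge0 T0'; lra.
  rewrite -subr_ge0 (_ : _ - _ =
    8 * (4 * u * (5 + 3 * u ^+ 2) * (1 + T ^+ 2) -
       T * (3 + T ^+ 2) * (5 + 10 * u ^+ 2 + u ^+ 4)) /
    ((1 + u) ^+ 4 * (1 + T) ^+ 4)).
    by rewrite divr_ge0 ?mulr_ge0 ?exprn_ge0 ?subr_ge0 ?(ltW u0) ?(ltW T0).
  by field; apply/andP; split; rewrite gt_eqF.
- rewrite (_ : _ + 1 ^+ 4 = 8 :> R); last by ring.
  by rewrite !expr1n; have := pow8_p0 R; lra.
- by rewrite t1 (ltW ht).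
Qed.

End GeometricInequality.

(** * The geometric inequality for all lengths *)

Section AllLengths.
Variable R : realType.
Local Notation p := (p0 R).
Implicit Types t : R.

(** Adding one term increases the left-hand side by at most
    [p d / A^(1-p)], where [A] is the old base and [d] its increment, and the
    right-hand side by [t^(p(n+1)) >= t^n].  For [n >= 4] the base satisfies
    [A >= (1 + t)^4 / 2 = 8 ((1 + t) / 2)^4], and [8^(1-p) >= 8/5] with
    [4 (1 - p) <= 1] gives [A^(1-p) >= 4/5 (1 + t) >= p (1 + t)]. *)
Lemma geom_step t n : 0 <= t <= 1 -> (4 <= n)%N ->
  ((1 + t) * \sum_(k < n) t ^+ k) `^ p <= \sum_(k < n.+1) (t `^ p) ^+ k ->
  ((1 + t) * \sum_(k < n.+1) t ^+ k) `^ p <= \sum_(k < n.+2) (t `^ p) ^+ k.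
Proof.
move=> /andP[t0 t1] n4 IH; have /andP[pl pu] := p0_bounds R.
rewrite [\sum_(k < n.+1) t ^+ k]big_ord_recr [leRHS]big_ord_recr/= mulrDr.
set A := (1 + t) * _ in IH *; set d := (1 + t) * t ^+ n.
have d0 : 0 <= d by rewrite mulr_ge0 ?exprn_ge0//; lra.
have A4 : (1 + t) ^+ 4 / 2 <= A.
  have -> : A = (1 + t) * (1 + t + t ^+ 2 + t ^+ 3) +
      (1 + t) * \sum_(4 <= k < n) t ^+ k.
    rewrite /A -(big_mkord xpredT) (big_cat_nat _ n4)//= mulrDr.
    by rewrite 4?big_nat_recl//= big_geq// addr0 !expr0 expr1; ring.
  have s0 : 0 <= (1 + t) * \sum_(4 <= k < n) t ^+ k.
    by rewrite mulr_ge0 ?sumr_ge0// => [|k _]; [lra|rewrite exprn_ge0].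
  have := sqr_ge0 (1 - t); have := sqr_ge0 (1 + t); nra.
have A0 : 0 < A by have := exprn_gt0 4 (_ : 0 < 1 + t); lra.
have incr : (A + d) `^ p * A `^ (1 - p) <= A + p * d.
  have := powR_amgm (p0_in01 R) (ltW A0) (addr_ge0 (ltW A0) d0); lra.
suff last_term : p * d <= A `^ (1 - p) * (t `^ p) ^+ n.+1.
  have AE : A `^ p * A `^ (1 - p) = A.
    by rewrite -powRD ?(gt_eqF A0) ?implybT// subrKC powRr1// ltW.
  have q0 : 0 < A `^ (1 - p) by rewrite powR_gt0.
  rewrite -(ler_pM2r q0) mulrDl.
  have := ler_wpM2r (ltW q0) IH; lra.
have half : 4 / 5 * (1 + t) <= A `^ (1 - p).
  apply: (@le_trans _ _ (((1 + t) ^+ 4 / 2) `^ (1 - p))); last first.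
    rewrite ge0_ler_powR// ?nnegrE ?(ltW A0)//; first by lra.
    by rewrite divr_ge0// exprn_ge0; lra.
  have -> : (1 + t) ^+ 4 / 2 = 8 * ((1 + t) / 2) ^+ 4 by field.
  rewrite powRM// ?exprn_ge0//; try lra.
  have h8 : 8 / 5 <= (8 : R) `^ (1 - p).
    rewrite powRB ?powRr1// ?pnatr_eq0 ?implybT//.
    by rewrite ler_pdivlMr ?powR_gt0//; have := pow8_p0 R; lra.
  have hz : (1 + t) / 2 <= (((1 + t) / 2) ^+ 4) `^ (1 - p).
    rewrite -powR_mulrn; last lra.
    by rewrite -powRrM ger1_powR//; [apply/andP; split|]; lra.
  have := @ler_pM _ (8/5) _ ((1 + t) / 2) _ _ _ h8 hz; lra.
have tn : t ^+ n <= (t `^ p) ^+ n.+1.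
  have [->|tn0] := eqVneq t 0.
    by rewrite expr0n gtn_eqF ?(leq_trans _ n4)// exprn_ge0 ?powR_ge0.
  rewrite -powR_mulrn// -powR_mulrn ?powR_ge0// -powRrM.
  apply: ger_powR; first by rewrite lt_def tn0 t0 t1.
  have : (4 : R) <= n%:R by rewrite ler_nat.
  rewrite -[n.+1%:R]natr1; nra.
have tn0 := exprn_ge0 n t0.
have z0 : 0 <= 4 / 5 * (1 + t) by lra.
apply: le_trans (ler_pM z0 tn0 half tn).
by rewrite /d mulrA ler_wpM2r// ler_wpM2r; lra.
Qed.

Lemma geom_ineq n t : 0 <= t <= 1 ->
  ((1 + t) * \sum_(k < n) t ^+ k) `^ p <= \sum_(k < n.+1) (t `^ p) ^+ k.
Proof.
move=> t01; have /andP[p0 p1] := p0_in01 R.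
case: n => [|[|[|[|n]]]].
- by rewrite big_ord0 mulr0 powR0 ?gt_eqF// big_ord1 expr0.
- rewrite big_ord1 mulr1 !big_ord_recr big_ord0/= expr0 add0r expr1.
  by apply: powR_subadd; [rewrite p0 ltW|case/andP: t01].
- have := geom_ineq2 t01; rewrite !big_ord_recr !big_ord0/= !expr0 !expr1 !add0r.
  by congr (_ `^ _ <= _); ring.
- have := geom_ineq3 t01; rewrite !big_ord_recr !big_ord0/= !expr0 !expr1 !add0r.
  by congr (_ `^ _ <= _); ring.
elim: n => [|n IH]; last exact: geom_step.
have := geom_ineq4 t01; rewrite !big_ord_recr !big_ord0/= !expr0 !expr1 !add0r.
by congr (_ `^ _ <= _); ring.
Qed.
End AllLengths.

(** * Linear forms tested on geometric blocks *)

Section GeometricTests.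
Variables (R : realFieldType) (s K : R).
Hypothesis s0 : 0 <= s.
Implicit Types (w x c : nat -> R).

(** Value of the linear form with coefficients [w] on the geometric block
    [(1, s, ..., s^(n-1))], minus [K] times the cost of that block. *)
Definition geom_test w n : R :=
  \sum_(l < n) w l * s ^+ l - K * \sum_(l < n.+1) s ^+ l.

Lemma geom_test0 w : geom_test w 0 = - K.
Proof. by rewrite /geom_test big_ord0 big_ord1 expr0 mulr1 add0r. Qed.

Lemma geom_testS w n :
  geom_test w n.+1 = w 0%N - K + s * geom_test (fun l => w l.+1) n.
Proof.
have recl (v : nat -> R) m : \sum_(l < m.+1) v l * s ^+ l =
    v 0%N + s * \sum_(l < m) v l.+1 * s ^+ l.
  rewrite big_ord_recl expr0 mulr1 mulr_sumr; congr (_ + _).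
  by apply: eq_bigr => l _; rewrite lift0 exprS mulrCA.
have := recl (fun=> 1) n.+1; have := recl w n; rewrite /geom_test /=.
under [in X in _ -> X -> _]eq_bigr do rewrite mul1r.
under [in X in _ -> (_ = X) -> _]eq_bigr do rewrite mul1r.
by move=> -> ->; ring.
Qed.

(** The number [y] is the carry from the preceding entry: it forces
    [c_0 >= y].  A slope [u <= 0] above all tests of the blocks that start at
    the first position bounds the gain from carrying [y].  In the induction,
    [u] is turned into such a slope [v] for the shifted sequence; the gain, as
    a function of [x_0], then has slope [u + K >= 0] below [y] and [u <= 0]
    above it, so it is largest at [x_0 = y]. *)
Lemma le_of_geom_tests n w x c (y u : R) : u <= 0 ->
  (forall j, (j <= n)%N -> geom_test w j <= u) ->
  (forall i j, (i + j <= n)%N -> geom_test (fun l => w (i + l)%N) j <= 0) ->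
  0 <= y <= c 0%N ->
  (forall k, (k < n)%N -> 0 <= x k <= c k /\ s * x k <= c k.+1) ->
  \sum_(k < n) w k * x k - K * \sum_(k < n.+1) c k <= u * y.
Proof.
elim: n w x c y u => [|n IH] w x c y u u0 wu w0 /andP[y0 yc] xc.
  rewrite big_ord0 big_ord1 add0r.
  have := wu 0%N isT; rewrite geom_test0 => Ku; nra.
pose w' l := w l.+1.
(* [v] is the largest slope that the bound [u] leaves for the carry
   [s * x 0], truncated at 0. *)
have [v [v0 wv uv]] : exists v, [/\ v <= 0,
    forall j, (j <= n)%N -> geom_test w' j <= v & w 0%N - K + s * v <= u].
  have w'0 j : (j <= n)%N -> geom_test w' j <= 0 by move=> jn; apply: (w0 1%N).
  have [sE|sN] := eqVneq s 0.
    exists 0; split=> //.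
    by have := wu 1%N isT; rewrite geom_testS sE !mul0r.
  have sp : 0 < s by rewrite lt_def sN.
  exists (Num.min 0 ((u - w 0%N + K) / s)); split.
  - by rewrite ge_min lexx.
  - move=> j jn; rewrite le_min w'0//= ler_pdivlMr//.
    by have := wu j.+1 jn; rewrite geom_testS -/w'; lra.
  - have : Num.min 0 ((u - w 0%N + K) / s) <= (u - w 0%N + K) / s.
      by rewrite ge_min lexx orbT.
    by rewrite ler_pdivlMr//; lra.
have [/andP[x0 xc0] sx0] := xc 0%N isT.
have tail : \sum_(k < n) w' k * x k.+1 - K * \sum_(k < n.+1) c k.+1 <=
    v * (s * x 0%N).
  apply: (IH w' (fun k => x k.+1) (fun k => c k.+1)) => //.
  - by move=> i j ij; apply: (w0 i.+1).
  - by rewrite mulr_ge0.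
  - by move=> k kn; apply: xc.
rewrite big_ord_recl [\sum_(k < n.+2) _]big_ord_recl.
under eq_bigr do rewrite lift0.
under [\sum_(i < n.+1) _]eq_bigr do rewrite lift0.
move: tail; rewrite /w'; move: (\sum_(i < n) _) (\sum_(i < n.+1) _) => S1 S2 tail.
have Ku : - K <= u by have := wu 0%N isT; rewrite geom_test0.
have uvx : (w 0%N - K + s * v) * x 0%N <= u * x 0%N by rewrite ler_wpM2r.
(* Either [c 0] is at least [x 0 >= y], or [c 0] is at least [y > x 0]. *)
suff : u * x 0%N + K * (x 0%N - c 0%N) <= u * y by lra.
by have [yx|xy] := lerP y (x 0%N); nra.
Qed.
End GeometricTests.

(** * The inequality between slices *)

Section Slicing.
Variable R : realType.
Local Notation p := (p0 R).

(** The linear form with coefficients [b_k^(1-p)] takes the value [sum_k b_k]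
    on the vector of the [b_k^p].  Hoelder's inequality and [geom_ineq] bound
    it on all geometric blocks of ratio [t^p]. *)
Lemma slice_ineq_le (a0 a1 : R) n (b c : nat -> R) : 0 <= a1 <= a0 ->
  (forall k, 0 <= b k) -> (forall k, 0 <= c k) ->
  (forall k, (k < n)%N -> (a0 * b k) `^ p <= c k /\ (a1 * b k) `^ p <= c k.+1) ->
  ((a0 + a1) * \sum_(k < n) b k) `^ p <= \sum_(k < n.+1) c k.
Proof.
move=> /andP[a10 a1a0] b0 c0 bc; have p01 := p0_in01 R.
have /andP[p_gt0 p_lt1] := p01.
have a00 : 0 <= a0 by lra.
have pN0 : p != 0 by rewrite gt_eqF.
have sc0 : 0 <= \sum_(k < n.+1) c k by rewrite sumr_ge0.
have [a0E|a0N] := eqVneq a0 0.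
  by rewrite (_ : a0 + a1 = 0) ?mul0r ?powR0//; lra.
have a0p : 0 < a0 by rewrite lt_def a0N.
set Z := \sum_(k < n) b k; have Z0 : 0 <= Z by rewrite sumr_ge0.
have [ZE|ZN] := eqVneq Z 0; first by rewrite ZE mulr0 powR0.
have Zp : 0 < Z by rewrite lt_def ZN.
(* [K] is the norm of the dual vector divided by the constant of [geom_ineq]. *)
pose t := a1 / a0; have t01 : 0 <= t <= 1.
  by rewrite /t divr_ge0//= ler_pdivrMr// mul1r.
have /andP[t0 t1] := t01; have z0 : 0 < 1 + t by lra.
pose K := Z `^ (1 - p) / (1 + t) `^ p.
have K0 : 0 <= K by rewrite divr_ge0 ?powR_ge0.
have cst0 : 0 < a0 `^ p by rewrite powR_gt0.
have tests i j : (i + j <= n)%N ->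
    geom_test (t `^ p) K (fun l => b (i + l)%N `^ (1 - p)) j <= 0.
  move=> ij; rewrite subr_le0.
  rewrite (eq_bigr (fun l : 'I_j => b (i + l)%N `^ (1 - p) * (t ^+ l) `^ p));
    last by move=> l _; rewrite powR_exprn.
  apply: (le_trans (@powR_holder _ p j (fun k => b (i + k)%N) (GRing.exp t)
    p01 _ _)) => //.
    by move=> k; rewrite exprn_ge0.
  have sub : (\sum_(k < j) b (i + k)%N) `^ (1 - p) <= Z `^ (1 - p).
    apply: ge0_ler_powR; rewrite ?nnegrE ?sumr_ge0//; first by lra.
    have -> : \sum_(k < j) b (i + k)%N = \sum_(i <= k < i + j) b k.
      rewrite -[in RHS](add0n i) big_addn add0n addKn big_mkord.
      by apply: eq_bigr => k _; rewrite addnC.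
    rewrite /Z -(big_mkord xpredT b) (big_cat_nat (leq0n (i + j)) ij)//=.
    rewrite (big_cat_nat (leq0n i) (leq_addr j i))//=.
    by rewrite addrAC lerDr addr_ge0 ?sumr_ge0.
  have := geom_ineq j t01; rewrite powRM ?(ltW z0)//; last first.
    by rewrite sumr_ge0// => k _; rewrite exprn_ge0.
  rewrite -ler_pdivlMl ?powR_gt0// => g.
  apply: le_trans (ler_pM (powR_ge0 _ _) (powR_ge0 _ _) sub g) _.
  by rewrite /K mulrA.
have : \sum_(k < n) b k `^ (1 - p) * b k `^ p -
    K * \sum_(k < n.+1) (c k / a0 `^ p) <= 0 * 0.
  apply: (@le_of_geom_tests _ (t `^ p) K (powR_ge0 _ _) n
    (fun k => b k `^ (1 - p)) (fun k => b k `^ p) (fun k => c k / a0 `^ p)) => //.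
  - by move=> j; exact: (tests 0%N).
  - by rewrite lexx divr_ge0// ltW.
  - move=> k kn; have [h0 h1] := bc k kn.
    rewrite powR_ge0/= !ler_pdivlMr// -!powRM ?mulr_ge0 ?invr_ge0//.
    split; first by rewrite mulrC.
    by move: h1; congr (_ `^ _ <= _); rewrite /t; field.
rewrite mul0r.
have -> : \sum_(k < n) b k `^ (1 - p) * b k `^ p = Z.
  apply: eq_bigr => k _; have [->|bN] := eqVneq (b k) 0.
    by rewrite powR0 ?mul0r// gt_eqF// subr_gt0.
  by rewrite -powRD ?subrK ?powRr1// (negPf bN) implybT.
rewrite -mulr_suml subr_le0.
have ZE : Z = Z `^ (1 - p) * Z `^ p.
  by rewrite -powRD ?subrK ?powRr1// ZN implybT.
rewrite {1}ZE /K -!mulrA ler_pM2l ?powR_gt0//.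
rewrite ler_pdivlMl ?powR_gt0// ler_pdivlMr//.
rewrite -!powRM ?mulr_ge0 ?(ltW z0)//.
by congr (_ `^ _ <= _); rewrite /t; field.
Qed.

(** Reversing the order of the [b_k] exchanges the roles of [a0] and [a1]. *)
Lemma slice_ineq (a0 a1 : R) n (b c : nat -> R) : 0 <= a0 -> 0 <= a1 ->
  (forall k, 0 <= b k) -> (forall k, 0 <= c k) ->
  (forall k, (k < n)%N -> (a0 * b k) `^ p <= c k /\ (a1 * b k) `^ p <= c k.+1) ->
  ((a0 + a1) * \sum_(k < n) b k) `^ p <= \sum_(k < n.+1) c k.
Proof.
move=> a00 a10 b0 c0 bc; have [a01|a10'] := lerP a1 a0.
  by apply: slice_ineq_le; rewrite ?a10.
rewrite addrC (reindex_inj rev_ord_inj) [leRHS](reindex_inj rev_ord_inj)/=.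
apply: (@slice_ineq_le a1 a0 n (fun k => b (n - k.+1)%N)
  (fun k => c (n.+1 - k.+1)%N)) => //.
  by rewrite a00 ltW.
move=> k kn; have [|h0 h1] := bc (n - k.+1)%N.
  by rewrite ltn_subrL (leq_trans _ kn).
by split; rewrite subSS // -[X in c X]subnSK.
Qed.
End Slicing.

(** * Sumsets *)

Section Sumsets.
Lemma card_fibers (T : choiceType) (f : T -> int) n (X : {fset T}) :
  (forall x, x \in X -> 0 <= f x < n%:Z) ->
  #|` X| = (\sum_(k < n) #|` [fset x in X | f x == k%:Z]%fset|)%N.
Proof.
move=> fX; rewrite card_fset_sum1 big_seq.
rewrite (eq_bigr (fun x => \sum_(k < n | f x == k%:Z) 1)%N); last first.
  move=> x /fX /andP[f0 fn].
  have kn : (`|f x| < n)%N by lia.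
  rewrite (big_pred1 (Ordinal kn))// => k /=.
  by apply/eqP/eqP => [fk|->/=]; [apply: val_inj => /=|]; lia.
rewrite -big_seq (exchange_big_dep xpredT)//=; apply: eq_bigr => k _.
by rewrite card_fset_sum1 big_fset_condE.
Qed.

Variables (R : realType) (d m : nat).
Local Notation p := (p0 R).
Local Notation vec := 'rV[int]_d.

Lemma minkowski_sumP (V : zmodType) (A B : {fset V}) (v : V) :
  reflect (exists a b, [/\ a \in A, b \in B & v = a + b]) (v \in minkowski_sum A B).
Proof.
apply: (iffP (imfset2P _ _ _ _ _)) => /= [[a aA [b bB ->]]|[a [b [aA bB ->]]]].
  by exists a, b.
by exists a => //; exists b.
Qed.

(** Induction on the set of coordinates that may vary keeps all the slices
    in the same ambient space. *)
Definition agree_outside (S : seq 'I_d) (X : {fset vec}) :=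
  forall v w, v \in X -> w \in X -> forall i, i \notin S -> v ord0 i = w ord0 i.

Lemma boxP n (X : {fset vec}) : {subset X <= box n d} ->
  forall i v, v \in X -> 0 <= v ord0 i <= n%:Z.
Proof. by move=> Xb i v /Xb; rewrite inE => /forallP. Qed.

(** Slicing along the coordinate [i] leaves sets whose elements also agree
    at [i], so the induction hypothesis applies to all pairs of slices. *)
Lemma sumset_agree_outside (S : seq 'I_d) (A B : {fset vec}) :
  {subset A <= box 1 d} -> {subset B <= box m d} ->
  agree_outside S A -> agree_outside S B ->
  (#|` A|%:R * #|` B|%:R) `^ p <= #|` minkowski_sum A B|%:R :> R.
Proof.
have /andP[p_gt0 p_lt1] := p0_in01 R.
elim: S A B => [|i S IH] A B Ab Bb AS BS.
  have small X : agree_outside [::] X -> (#|` X| <= 1)%N.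
    move=> XS; have [->|[x xX]] := fset_0Vmem X; first by rewrite cardfs0.
    rewrite -[leqRHS](cardfs1 x) fsubset_leq_card//; apply/fsubsetP => y yX.
    by rewrite inE; apply/eqP/rowP => j; exact: XS.
  have [->|[a aA]] := fset_0Vmem A; first by rewrite cardfs0 mul0r powR0 ?gt_eqF.
  have [->|[b bB]] := fset_0Vmem B; first by rewrite cardfs0 mulr0 powR0 ?gt_eqF.
  have AB1 : (0 < #|` minkowski_sum A B|)%N.
    rewrite cardfs_gt0; apply/fset0Pn; exists (a + b).
    by apply/minkowski_sumP; exists a, b.
  apply: (@le_trans _ _ (1 `^ p)); last by rewrite powR1 ler1n.
  rewrite ge0_ler_powR ?(ltW p_gt0)// ?nnegrE ?mulr_ge0// -natrM lern1.
  by rewrite (@leq_mul _ _ 1 1) ?small.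
pose fib (X : {fset vec}) (k : nat) := [fset v in X | v ord0 i == k%:Z]%fset.
have fibS X k : (fib X k `<=` X)%fset by apply/fsubsetP => v; rewrite !inE => /andP[].
have fib_agree X k : agree_outside (i :: S) X -> agree_outside S (fib X k).
  move=> XS v w; rewrite !inE => /andP[vX /eqP vk] /andP[wX /eqP wk] j jS.
  have [->|ji] := eqVneq j i; first by rewrite vk wk.
  by apply: XS => //; rewrite inE negb_or ji.
set C := minkowski_sum A B.
have AE : #|` A| = (#|` fib A 0%N| + #|` fib A 1%N|)%N.
  rewrite (@card_fibers _ (fun v : vec => v ord0 i) 2 A) => [|v /(boxP Ab i)/=]; last lia.
  by rewrite !big_ord_recl big_ord0 addn0.
have BE : #|` B| = (\sum_(k < m.+1) #|` fib B k|)%N.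
  by apply: card_fibers => v /(boxP Bb i) /=; lia.
have CE : #|` C| = (\sum_(k < m.+2) #|` fib C k|)%N.
  apply: card_fibers => v /minkowski_sumP[a [b [/(boxP Ab i) ha /(boxP Bb i) hb ->]]].
  by move: ha hb; rewrite mxE; move: (a ord0 i) (b ord0 i) => x y; lia.
have layer e k : (#|` fib A e|%:R * #|` fib B k|%:R) `^ p <= #|` fib C (e + k)%N|%:R :> R.
  apply: (@le_trans _ _ (#|` minkowski_sum (fib A e) (fib B k)|%:R)).
    apply: IH; [| |exact: fib_agree|exact: fib_agree].
    - by move=> v /(fsubsetP (fibS _ _)) /Ab.
    - by move=> v /(fsubsetP (fibS _ _)) /Bb.
  rewrite ler_nat; apply: fsubset_leq_card; apply/fsubsetP => v.
  move=> /minkowski_sumP[a [b []]].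
  rewrite !inE => /andP[aA /eqP ae] /andP[bB /eqP bk] ->.
  by rewrite mxE ae bk eqxx andbT; apply/minkowski_sumP; exists a, b.
rewrite AE BE CE natrD !natr_sum.
apply: (@slice_ineq R _ _ m.+1 (fun k => #|` fib B k|%:R)
  (fun k => #|` fib C k|%:R)); try by move=> *; rewrite ler0n.
by move=> k _; split; [exact: (layer 0%N)|exact: (layer 1%N)].
Qed.
End Sumsets.

Theorem corollary1p7 (R : realType) :
  (forall (m d : nat), (1 <= m)%N -> (1 <= d)%N ->
     forall A B : {fset 'rV[int]_d},
       {subset A <= box 1 d} -> {subset B <= box m d} ->
       (#|` A|%:R * #|` B|%:R) `^ (p0 R) <= #|` minkowski_sum A B|%:R :> R)
  /\
  (forall m : nat, (2 <= m)%N -> forall p : R, p0 R < p ->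
     exists d : nat, (1 <= d)%N /\
       exists A B : {fset 'rV[int]_d},
         [/\ {subset A <= box 1 d}, {subset B <= box m d} &
             #|` minkowski_sum A B|%:R < (#|` A|%:R * #|` B|%:R) `^ p :> R]).
Proof.
split=> [m d _ _ A B Ab Bb|m m2 p pp].
  by apply: (sumset_agree_outside R (S := enum 'I_d) Ab Bb) => v w _ _ i;
    rewrite mem_enum.
pose I n : {fset 'rV[int]_1} := [fset const_mx k%:Z | k in iota 0 n]%fset.
have cardI n : #|` I n| = n.
  rewrite card_in_imfset/= ?undup_id ?iota_uniq ?size_iota// => x y _ _.
  by move=> /matrixP/(_ ord0 ord0); rewrite !mxE => -[].
have Ib n k : (n <= k.+1)%N -> {subset I n <= box k 1}.
  move=> nk v /imfsetP[j /=]; rewrite mem_iota => /andP[_ jn] ->.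
  by rewrite inE; apply/forallP => i; rewrite mxE; lia.
exists 1%N; split=> //; exists (I 2), (I 3); split; [exact: Ib|exact: Ib|].
have sub : (minkowski_sum (I 2) (I 3) `<=` I 4)%fset.
  apply/fsubsetP => v.
  move=> /minkowski_sumP[_ [_ [/imfsetP[j /= jI ->] /imfsetP[k /= kI ->] ->]]].
  apply/imfsetP; exists (j + k)%N; last by apply/matrixP => ? ?; rewrite !mxE PoszD.
  by move: jI kI; rewrite !inE => /orP[] /eqP -> /or3P[] /eqP ->.
apply: (@le_lt_trans _ _ 4); first by rewrite -[4%N]cardI ler_nat fsubset_leq_card.
rewrite !cardI -natrM -[ltLHS](pow6_p0 R) /powR gt_eqF ?ltr0n//.
by rewrite ltr_expR ltr_pM2r ?ln6_gt0.
Qed.
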